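(* Let $a>0$, $b>0$. Then $(a,\,b,\,2a)\in\mathcal{P}_{1,2}$ if and only if $b>a+\frac12$. Moreover, in this case, for all $x>0$, $${}_1F_2\left(a\,;b,\,2a\,;-\tfrac{x^2}{4}\right)>\mathbb{J}_{b-1}^2\left(\frac{x}{2}\right).$$
   Context: For $a,b,c>0$, ${}_1F_2\left(a\,;b,c\,;-\frac{x^2}{4}\right)=\sum_{k=0}^\infty \frac{(a)_k}{k!\,(b)_k(c)_k}\left(-\frac{x^2}{4}\right)^k$, where $(\alpha)_k=\Gamma(\alpha+k)/\Gamma(\alpha)$. $\mathcal{P}_{1,2}$ denotes the set of all triples $(a,b,c)$ of positive reals such that this function is $>0$ for all $x>0$. For $\alpha>-1$, $\mathbb{J}_\alpha(x)={}_0F_1\left(\alpha+1\,;-\frac{x^2}{4}\right)=\Gamma(\alpha+1)(x/2)^{-\alpha}J_\alpha(x)$, with $J_\alpha$ the Bessel function of the first kind. *)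

(* Defs.v *)
From Stdlib Require Import Reals.
From Coquelicot Require Import Coquelicot.
Open Scope R_scope.

Fixpoint poch (alpha : R) (k : nat) : R :=
  match k with
  | O => 1
  | S k' => poch alpha k' * (alpha + INR k')
  end.

(* 1F2(a; b, c; -x^2/4) as the sum of its (everywhere convergent) series. *)
Definition F12 (a b c x : R) : R :=
  Series (fun k => poch a k / (INR (Factorial.fact k) * poch b k * poch c k)
                   * (- x ^ 2 / 4) ^ k).

Definition F01 (beta x : R) : R :=
  Series (fun k => 1 / (INR (Factorial.fact k) * poch beta k) * (- x ^ 2 / 4) ^ k).

Definition bbJ (alpha x : R) : R := F01 (alpha + 1) x.

Definition in_P12 (a b c : R) : Prop :=
  0 < a /\ 0 < b /\ 0 < c /\ forall x : R, 0 < x -> 0 < F12 a b c x.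

(* Main.v *)
Require Import Defs.
From Stdlib Require Import Reals Lra Lia Factorial Compare_dec Classical.
From Coquelicot Require Import Coquelicot.
Open Scope R_scope.

(* Gasper's sums of squares: with w = -x^2/16 and mu = b - 1/2 - a,
     1F2(a; b, 2a; 4w) = sum_m c_m w^(2m) F_(b+2m)(w)^2,
     c_m = (b-1+2m) (b)_(m-1) (mu)_m / (m! (a+1/2)_m ((b)_(2m))^2),   c_0 = 1,
   where F_beta(w) = 0F1(beta; w).  Comparing coefficients, this is a terminating
   very-well-poised sum, proved by a telescoping (WZ) certificate.  If mu > 0 all
   c_m are positive, which gives the strict bound by the term m = 0.  If
   -1 < mu <= 0 then c_m <= 0 for m >= 1, so the 1F2 is nonpositive at the zeros of
   F_b.  Smaller b reduce to this case because positivity for b implies positivity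
   for b + 1. *)

(** * Pochhammer symbols and the Chu-Vandermonde sum *)

Lemma poch_pos (x : R) (k : nat) : 0 < x -> 0 < poch x k.
Proof.
  intros hx; induction k as [|k IH]; simpl; [lra|].
  pose proof (pos_INR k).
  apply Rmult_lt_0_compat; lra.
Qed.

Lemma poch_add (x : R) (i j : nat) :
  poch x (i + j) = poch x i * poch (x + INR i) j.
Proof.
  induction j as [|j IH].
  - rewrite Nat.add_0_r; simpl; ring.
  - rewrite Nat.add_succ_r; simpl; rewrite IH, plus_INR; ring.
Qed.

Lemma poch_succ_l (x : R) (k : nat) : poch x (S k) = x * poch (x + 1) k.
Proof. change (S k) with (1 + k)%nat; rewrite poch_add; simpl; ring. Qed.

(** Reverse the order of the k factors and change the sign of each. *)
Lemma poch_reflect (x : R) (k : nat) :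
  poch x k = (-1) ^ k * poch (1 - x - INR k) k.
Proof.
  revert x; induction k as [|k IH]; intros x; [simpl; ring|].
  rewrite (poch_succ_l (1 - x - INR (S k))).
  replace (1 - x - INR (S k) + 1) with (1 - x - INR k)
    by (rewrite S_INR; ring).
  rewrite S_INR; simpl; rewrite IH; ring.
Qed.

Lemma poch_opp_nat (N k : nat) :
  (k <= N)%nat ->
  poch (- INR N) k * INR (fact (N - k)) = (-1) ^ k * INR (fact N).
Proof.
  induction k as [|k IH]; intros hk.
  - rewrite Nat.sub_0_r; simpl; ring.
  - specialize (IH ltac:(lia)).
    replace (N - k)%nat with (S (N - S k)) in IH by lia.
    rewrite fact_simpl, mult_INR in IH.
    replace (INR (S (N - S k))) with (INR N - INR k) in IH
      by (rewrite S_INR, minus_INR, S_INR by lia; ring).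
    cbn [poch pow]; rewrite (Rmult_assoc (-1)), <- IH; ring.
Qed.

Lemma poch_opp_nat_eq0 (N k : nat) : (N < k)%nat -> poch (- INR N) k = 0.
Proof.
  intros h; replace k with (S N + (k - S N))%nat by lia.
  rewrite poch_add; simpl; ring.
Qed.

(** Chu-Vandermonde: the coefficient of t^n in (1-t)^(-x) (1-t)^(-y) = (1-t)^(-x-y). *)
Lemma vandermonde (x y : R) (n : nat) :
  sum_f_R0 (fun i => poch x i / INR (fact i)
                     * (poch y (n - i) / INR (fact (n - i)))) n
  = poch (x + y) n / INR (fact n).
Proof.
  set (p := fun x i => poch x i / INR (fact i)).
  assert (hp : forall x i, INR (S i) * p x (S i) = (x + INR i) * p x i).
  { intros z i; unfold p; rewrite fact_simpl, mult_INR; simpl poch.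
    field; split; [apply INR_fact_neq_0 | apply not_0_INR; lia]. }
  change (sum_f_R0 (fun i => p x i * p y (n - i)%nat) n = p (x + y) n).
  induction n as [|n IH]; [unfold p; simpl; field|].
  apply (Rmult_eq_reg_l (INR (S n))); [|apply not_0_INR; lia].
  rewrite hp, <- IH, !scal_sum.
  (* The factor n + 1 is split as i + (n + 1 - i), so that [hp] can lower one index in each half;
     the weights then add up to x + y + n. *)
  rewrite (sum_eq _ (fun i => INR i * p x i * p y (S n - i)%nat
                       + p x i * (INR (S n - i) * p y (S n - i)%nat))).
  2:{ intros i hi; rewrite minus_INR by lia; ring. }
  rewrite sum_plus.
  rewrite decomp_sum by lia.
  rewrite (tech5 (fun i => p x i * (INR (S n - i) * p y (S n - i)%nat))).
  rewrite Nat.sub_diag; simpl pred; simpl (INR 0).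
  rewrite !Rmult_0_l, Rmult_0_r, Rplus_0_l, Rplus_0_r, <- sum_plus.
  apply sum_eq; intros i hi.
  rewrite hp; replace (S n - S i)%nat with (n - i)%nat by lia.
  replace (S n - i)%nat with (S (n - i)) by lia.
  rewrite hp, minus_INR by lia; ring.
Qed.

(** * Squares of Bessel series and the coefficient form of Gasper's expansion *)

Definition besselCoef (beta : R) (k : nat) : R :=
  1 / (INR (fact k) * poch beta k).

(** Reflection gives 1/(beta)_i = (-1)^(n-i) (y)_(n-i) / (beta)_n with y = 1 - beta - n, which turns
    the Cauchy product into a Vandermonde sum with both parameters y; a last reflection of (2y)_n
    gives the numerator. *)
Lemma besselCoef_sqr (beta : R) (n : nat) :
  0 < beta ->
  PS_mult (besselCoef beta) (besselCoef beta) n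
  = poch (2 * beta + INR n - 1) n / (INR (fact n) * poch beta n ^ 2).
Proof.
  intros hb; unfold PS_mult.
  set (y := 1 - beta - INR n).
  pose proof (poch_pos beta n hb) as hn.
  rewrite (sum_eq _ (fun i => poch y i / INR (fact i)
     * (poch y (n - i) / INR (fact (n - i))) * ((-1) ^ n / poch beta n ^ 2))).
  - rewrite <- scal_sum, vandermonde.
    rewrite (poch_reflect (2 * beta + INR n - 1)).
    replace (1 - (2 * beta + INR n - 1) - INR n) with (y + y) by (unfold y; ring).
    field; split; [lra | apply INR_fact_neq_0].
  - intros i hi; unfold besselCoef.
    pose proof (poch_pos beta i hb) as h1.
    pose proof (poch_pos beta (n - i) hb) as h2.
    assert (e1 : poch beta n = poch beta i * ((-1) ^ (n - i) * poch y (n - i))).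
    { replace n with (i + (n - i))%nat at 1 by lia.
      rewrite poch_add, (poch_reflect (beta + INR i)).
      replace (1 - (beta + INR i) - INR (n - i)) with y
        by (unfold y; rewrite minus_INR by lia; ring).
      reflexivity. }
    assert (e2 : poch beta n = poch beta (n - i) * ((-1) ^ i * poch y i)).
    { replace n with ((n - i) + i)%nat at 1 by lia.
      rewrite poch_add, (poch_reflect (beta + INR (n - i))).
      replace (1 - (beta + INR (n - i)) - INR i) with y
        by (unfold y; rewrite minus_INR by lia; ring).
      reflexivity. }
    replace ((-1) ^ n) with ((-1) ^ i * (-1) ^ (n - i))
      by (rewrite <- pow_add; f_equal; lia).
    (* Brings in (beta)_n twice, to be rewritten once by [e1] and once by [e2]. *)
    replace (1 / (INR (fact i) * poch beta i)
             * (1 / (INR (fact (n - i)) * poch beta (n - i))))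
      with (poch beta n * poch beta n
            / (poch beta i * poch beta (n - i) * poch beta n ^ 2)
            / (INR (fact i) * INR (fact (n - i))))
      by (field; repeat split; try apply INR_fact_neq_0; lra).
    rewrite e1 at 1; rewrite e2 at 1.
    field; repeat split; try apply INR_fact_neq_0; lra.
Qed.

(* For m = m' + 1, [b + 1 + 2 m'] is b - 1 + 2m and [poch b m'] is (b)_(m-1). *)
Definition sqCoef (a b : R) (m : nat) : R :=
  match m with
  | O => 1
  | S m' => (b + 1 + 2 * INR m') * poch b m' * poch (b - 1 / 2 - a) m
            / (INR (fact m) * poch (a + 1 / 2) m)
  end.

(** Contribution of the m-th square to the coefficient of w^N, relative to that of m = 0; the factor
    (-N)_(2m) vanishes once 2m > N. *)
Definition sqTerm (a b : R) (N m : nat) : R :=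
  sqCoef a b m * poch (- INR N) (2 * m) / poch (2 * b + INR N - 1) (2 * m).

(** The quotient, from N to N + 1, of the closed form that [sqCoef_sum] gives for the sum of
    [sqTerm]. *)
Definition sqRatio (a b : R) (N : nat) : R :=
  2 * (a + INR N) * (2 * b + INR N - 1)
  / ((2 * a + INR N) * (2 * b + 2 * INR N - 1)).

(* At N = 0 the junk value of a division by 2b + N - 1 = 0 would interfere. *)
Lemma sqCoef_telescope (a b : R) (N M : nat) :
  0 < a -> 0 < b ->
  (1 <= N)%nat ->
  sum_f_R0 (fun m => sqTerm a b (S N) m - sqRatio a b N * sqTerm a b N m) M
  = 2 * poch b M * poch (b - 1 / 2 - a) (S M) * poch (- INR N) (S (2 * M))
    / ((2 * a + INR N) * (2 * b + 2 * INR N - 1) * INR (fact M)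
       * poch (a + 1 / 2) M * poch (2 * b + INR N) (2 * M)).
Proof.
  intros ha hb hN; apply le_INR in hN; simpl (INR 1) in hN.
  induction M as [|M IH].
  - simpl; unfold sqTerm, sqRatio; simpl; field; split; lra.
  - rewrite tech5, IH; unfold sqTerm, sqRatio, sqCoef.
    pose proof (poch_pos b M hb) as h1.
    assert (h2 := poch_pos (a + 1 / 2) M ltac:(lra)).
    assert (h3 := poch_pos (2 * b + INR N) (2 * M) ltac:(lra)).
    pose proof (pos_INR M) as hM.
    pose proof (INR_fact_neq_0 M) as h4.
    rewrite fact_simpl, mult_INR.
    replace (2 * S M)%nat with (S (S (2 * M))) by lia.
    (* All symbols are reduced to the same few, so that the induction step is an identity of
       rational functions. *)
    assert (eN : poch (- INR (S N)) (S (S (2 * M)))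
                 = - (INR N + 1) * poch (- INR N) (S (2 * M))).
    { rewrite poch_succ_l, S_INR; do 2 f_equal; ring. }
    assert (eb : poch (2 * b + INR N - 1) (S (S (2 * M)))
                 = (2 * b + INR N - 1) * poch (2 * b + INR N) (2 * M)
                   * (2 * b + INR N + 2 * INR M)).
    { rewrite poch_succ_l.
      replace (2 * b + INR N - 1 + 1) with (2 * b + INR N) by ring.
      cbn [poch]; rewrite mult_INR; simpl (INR 2); ring. }
    rewrite eN, eb.
    replace (2 * b + INR (S N) - 1) with (2 * b + INR N) by (rewrite S_INR; ring).
    cbn [poch]; rewrite !S_INR, !mult_INR; simpl (INR 2).
    set (q := poch (- INR N) (2 * M)).
    set (r := poch (b - 1 / 2 - a) M).
    field; repeat split; lra.
Qed.

(** For M = N + 1 the telescoped sum is zero because (-N)_(2M+1) = 0, so the sums at N + 1 and N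
    have quotient [sqRatio]. This recurrence holds from N = 1 on, hence the two separate base
    cases. *)
Lemma sqCoef_sum (a b : R) (N : nat) :
  0 < a -> 0 < b ->
  sum_f_R0 (sqTerm a b N) N * poch (2 * b + INR N - 1) N
  = 4 ^ N * poch a N * poch b N / poch (2 * a) N.
Proof.
  intros ha hb.
  set (E := sqTerm a b).
  destruct N as [|N]; [unfold E, sqTerm; simpl; field|].
  induction N as [|N IH].
  - unfold E, sqTerm; simpl; field; lra.
  - set (n := S N) in *; set (rho := sqRatio a b).
    assert (hn : 1 <= INR n) by (unfold n; rewrite S_INR; pose proof (pos_INR N); lra).
    assert (h := sqCoef_telescope a b n (S n) ha hb ltac:(unfold n; lia)).
    fold E rho in h.
    rewrite (poch_opp_nat_eq0 n (S (2 * S n))) in h by lia.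
    rewrite minus_sum in h.
    rewrite (sum_eq (fun i => rho n * E n i) (fun i => E n i * rho n)) in h
      by (intros; ring).
    rewrite <- scal_sum in h.
    rewrite !tech5 in h.
    (* The sum at n gains nothing from m = n + 1, so both sums may run to n + 1. *)
    replace (E n (S n)) with 0 in h
      by (unfold E, sqTerm; rewrite (poch_opp_nat_eq0 n) by lia; unfold Rdiv; ring).
    assert (e : sum_f_R0 (E (S n)) (S n) = rho n * sum_f_R0 (E n) n).
    { unfold Rdiv in h; rewrite ?Rmult_0_r, ?Rmult_0_l in h.
      rewrite tech5; lra. }
    rewrite e.
    assert (ep : poch (2 * b + INR (S n) - 1) (S n) * (2 * b + INR n - 1)
      = poch (2 * b + INR n - 1) n * (2 * b + 2 * INR n - 1) * (2 * b + 2 * INR n)).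
    { rewrite S_INR.
      replace (2 * b + (INR n + 1) - 1) with (2 * b + INR n - 1 + 1) by ring.
      rewrite Rmult_comm, <- poch_succ_l; cbn [poch]; rewrite S_INR; ring. }
    assert (h1 := poch_pos (2 * a) n ltac:(lra)).
    unfold rho, sqRatio.
    transitivity (2 * (a + INR n) / ((2 * a + INR n) * (2 * b + 2 * INR n - 1))
      * sum_f_R0 (E n) n
      * (poch (2 * b + INR (S n) - 1) (S n) * (2 * b + INR n - 1))).
    { field; lra. }
    rewrite ep.
    transitivity (2 * (a + INR n) / ((2 * a + INR n))
      * (sum_f_R0 (E n) n * poch (2 * b + INR n - 1) n) * (2 * b + 2 * INR n)).
    { field; lra. }
    rewrite IH; cbn [poch pow]; field; lra.
Qed.

(** The coefficient of w^N on both sides of the expansion; 4^N comes from the argument 4w. By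
    [besselCoef_sqr] each summand is [sqTerm] times the summand m = 0. *)
Lemma sqCoef_expansion (a b : R) (N : nat) :
  0 < a -> 0 < b ->
  sum_f_R0 (fun m => sqCoef a b m / poch b (2 * m) ^ 2
     * PS_incr_n (PS_mult (besselCoef (b + INR (2 * m)))
                          (besselCoef (b + INR (2 * m)))) (2 * m) N) N
  = 4 ^ N * (poch a N / (INR (fact N) * poch b N * poch (2 * a) N)).
Proof.
  intros ha hb.
  assert (hbN := poch_pos b N hb).
  assert (haN := poch_pos (2 * a) N ltac:(lra)).
  pose proof (INR_fact_neq_0 N) as hf.
  transitivity (sum_f_R0 (sqTerm a b N) N * poch (2 * b + INR N - 1) N
                / (INR (fact N) * poch b N ^ 2)).
  2:{ rewrite sqCoef_sum by assumption; field; repeat split; lra. }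
  unfold Rdiv at 2; rewrite Rmult_assoc, Rmult_comm, scal_sum.
  apply sum_eq; intros m _.
  rewrite PS_incr_n_simplify.
  destruct (le_lt_dec (2 * m) N) as [hm|hm].
  - assert (hbm : 0 < b + INR (2 * m)) by (pose proof (pos_INR (2 * m)); lra).
    rewrite besselCoef_sqr by assumption.
    set (k := (2 * m)%nat) in *.
    assert (e1 : poch b N = poch b k * poch (b + INR k) (N - k)).
    { rewrite <- poch_add; f_equal; lia. }
    assert (e2 : poch (2 * b + INR N - 1) N
       = poch (2 * b + INR N - 1) k * poch (2 * (b + INR k) + INR (N - k) - 1) (N - k)).
    { replace N with (k + (N - k))%nat at 2 by lia; rewrite poch_add.
      rewrite minus_INR by lia; do 2 f_equal; ring. }
    assert (e3 := poch_opp_nat N k hm).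
    replace ((-1) ^ k) with 1 in e3
      by (unfold k; rewrite pow_mult; replace ((-1) ^ 2) with 1 by ring;
          rewrite pow1; reflexivity).
    rewrite Rmult_1_l in e3.
    pose proof (INR_fact_neq_0 (N - k)) as hf'.
    pose proof (poch_pos b k hb).
    pose proof (poch_pos (b + INR k) (N - k) hbm).
    (* For m = 0 the symbol is 1; otherwise N >= 2m gives N >= 1 and 2b + N - 1 > 0. *)
    assert (hp : poch (2 * b + INR N - 1) k <> 0).
    { destruct m as [|m]; [apply R1_neq_R0|].
      apply Rgt_not_eq, poch_pos.
      assert (1 <= INR N) by (apply (le_INR 1); lia); lra. }
    unfold sqTerm; fold k.
    rewrite e1, e2, <- e3; field; repeat split; try lra.
    intros h0; rewrite h0, Rmult_0_l in e3; lra.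
  - unfold sqTerm; rewrite poch_opp_nat_eq0 by lia.
    unfold Rdiv, zero; simpl; ring.
Qed.

Lemma sqCoef_pos (a b : R) (m : nat) :
  0 < a -> 0 < b -> a + 1 / 2 < b -> 0 < sqCoef a b m.
Proof.
  intros ha hb h; destruct m as [|m]; [simpl; lra|].
  unfold sqCoef; pose proof (pos_INR m).
  apply Rdiv_lt_0_compat; repeat apply Rmult_lt_0_compat;
    try apply INR_fact_lt_0; try apply poch_pos; lra.
Qed.

(** Here mu = b - 1/2 - a lies in (-1, 0], so in (mu)_m = mu (mu+1)_(m-1) only the first factor is
    nonpositive. *)
Lemma sqCoef_nonpos (a b : R) (m : nat) :
  0 < a -> 0 < b ->
  a - 1 / 2 < b -> b <= a + 1 / 2 -> (1 <= m)%nat -> sqCoef a b m <= 0.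
Proof.
  intros ha hb h1 h2 hm; destruct m as [|m]; [lia|].
  unfold sqCoef; pose proof (pos_INR m).
  rewrite (poch_succ_l (b - 1 / 2 - a)).
  assert (hm1 := poch_pos (b - 1 / 2 - a + 1) m ltac:(lra)).
  assert (hm2 := poch_pos (a + 1 / 2) (S m) ltac:(simpl; lra)).
  pose proof (INR_fact_lt_0 (S m)) as hf.
  pose proof (poch_pos b m hb) as hm3.
  match goal with |- ?t <= 0 => replace t with
    (- ((b + 1 + 2 * INR m) * poch b m * ((a + 1 / 2 - b)
       * poch (b - 1 / 2 - a + 1) m)
       / (INR (fact (S m)) * poch (a + 1 / 2) (S m)))) by (field; lra) end.
  apply Ropp_le_cancel; rewrite Ropp_0, Ropp_involutive.
  apply Rdiv_le_0_compat; [|apply Rmult_lt_0_compat; lra].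
  repeat apply Rmult_le_pos; lra.
Qed.

(** * Series tools: convergence, exchange of summations, signs, and transfer of positivity *)

Lemma CV_radius_infinite_of_ratio (u : nat -> R) (K : R) :
  (forall n, 0 < u n) -> (forall n, u (S n) * INR (S n) <= K * u n) ->
  CV_radius u = p_infty.
Proof.
  intros hu hK; apply CV_radius_infinite_DAlembert.
  - intros n; pose proof (hu n); lra.
  - apply is_lim_seq_le_le with (u := fun _ => 0) (w := fun n => K * / INR (S n)).
    + intros n; pose proof (hu n); pose proof (hu (S n)).
      assert (0 < INR (S n)) by (apply lt_0_INR; lia).
      rewrite Rabs_pos_eq by (apply Rlt_le, Rdiv_lt_0_compat; assumption).
      split; [apply Rlt_le, Rdiv_lt_0_compat; assumption|].
      apply Rle_div_l; [assumption|].
      apply Rmult_le_reg_r with (INR (S n)); [assumption|].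
      replace (K * / INR (S n) * u n * INR (S n)) with (K * u n) by (field; lra).
      apply hK.
    + apply is_lim_seq_const.
    + replace (Finite 0) with (Rbar_mult (Finite K) (Finite 0))
        by (simpl; f_equal; ring).
      apply is_lim_seq_scal_l.
      replace (Finite 0) with (Rbar_inv p_infty) by reflexivity.
      apply is_lim_seq_inv; [|discriminate].
      apply -> is_lim_seq_incr_1; apply is_lim_seq_INR.
Qed.

Lemma ex_pseries_of_infinite_radius (u : nat -> R) (z : R) :
  CV_radius u = p_infty -> ex_pseries u z.
Proof. intros h; apply CV_radius_inside; rewrite h; exact I. Qed.

(** Cutting every column sum at m <= M leaves the columns k <= M unchanged, and changes each later
    one by at most its absolute sum. The error after M rows is thus at most a tail of the convergent
    series of absolute column sums. *)
Lemma is_series_triangular (f : nat -> nat -> R) (L : nat -> R) :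
  (forall m k, (k < m)%nat -> f m k = 0) ->
  (forall m, is_series (f m) (L m)) ->
  ex_series (fun k => sum_f_R0 (fun m => Rabs (f m k)) k) ->
  is_series L (Series (fun k => sum_f_R0 (fun m => f m k) k)).
Proof.
  intros hf hL hg.
  set (g := fun k => sum_f_R0 (fun m => Rabs (f m k)) k) in *.
  set (u := fun k => sum_f_R0 (fun m => f m k) k).
  assert (hu : ex_series u).
  { apply (@ex_series_le R_AbsRing R_CompleteNormedModule u g); [|assumption].
    intros k; apply Rsum_abs. }
  assert (hv : forall M, is_series (fun k => sum_f_R0 (fun m => f m k) M)
                                   (sum_f_R0 L M)).
  { induction M as [|M IH]; [apply hL|].
    apply (is_series_plus _ _ _ _ IH (hL (S M))). }
  assert (hbound : forall M,
    Rabs (Series u - sum_f_R0 L M) <= Series g - sum_f_R0 g M).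
  { intros M; set (v := fun k => sum_f_R0 (fun m => f m k) M).
    assert (hd : forall k, Rabs (u (S M + k)%nat - v (S M + k)%nat) <= g (S M + k)%nat).
    { intros k; unfold u, v, g.
      set (F := fun m => f m (S M + k)%nat).
      change (Rabs (sum_f_R0 F (S M + k) - sum_f_R0 F M)
              <= sum_f_R0 (fun m => Rabs (F m)) (S M + k)).
      (* Splitting at M leaves only the rows above M in the difference. *)
      rewrite (tech2 F M (S M + k)), (tech2 (fun m => Rabs (F m)) M (S M + k)) by lia.
      match goal with |- Rabs (?x + ?y - ?x) <= _ =>
        replace (x + y - x) with y by ring end.
      eapply Rle_trans; [apply Rsum_abs|].
      rewrite <- (Rplus_0_l (sum_f_R0 _ (S M + k - S M))) at 1.
      apply Rplus_le_compat_r, cond_pos_sum; intros; apply Rabs_pos. }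
    rewrite <- (is_series_unique _ _ (hv M)).
    fold v.
    assert (hv' : ex_series v) by (eexists; apply hv).
    rewrite <- Series_minus by assumption.
    rewrite (Series_incr_n (fun n => u n - v n) (S M)) by
      (lia || apply (ex_series_minus u v hu hv')).
    rewrite (Series_incr_n g (S M)) by (lia || assumption).
    simpl pred.
    (* For k <= M the rows between k and M vanish by triangularity. *)
    replace (sum_f_R0 (fun n => u n - v n) M) with 0.
    2:{ symmetry; apply sum_eq_R0; intros k hk; unfold u, v.
        destruct (Nat.eq_dec k M) as [->|hkM]; [ring|].
        rewrite (tech2 _ k M) by lia.
        rewrite (sum_eq_R0 _ (M - S k)); [ring|].
        intros i _; apply hf; lia. }
    rewrite Rplus_0_l.
    replace (sum_f_R0 g M + Series (fun k => g (S M + k)%nat) - sum_f_R0 g M)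
      with (Series (fun k => g (S M + k)%nat)) by ring.
    assert (hgM : ex_series (fun k => g (S M + k)%nat)).
    { apply (ex_series_incr_n g); assumption. }
    eapply Rle_trans; [apply Series_Rabs|].
    - refine (@ex_series_le R_AbsRing R_CompleteNormedModule _ _ _ hgM); intros k.
      change (Rabs (Rabs (u (S M + k)%nat - v (S M + k)%nat)) <= g (S M + k)%nat).
      rewrite Rabs_Rabsolu; apply hd.
    - apply Series_le; [|assumption].
      intros k; split; [apply Rabs_pos | apply hd]. }
  assert (hlim : is_lim_seq (fun M => Series g - sum_f_R0 g M) 0).
  { replace (Finite 0) with (Finite (Series g - Series g)) by (f_equal; ring).
    apply is_lim_seq_minus'; [apply is_lim_seq_const|].
    apply is_lim_seq_ext with (sum_n g); [intros; apply sum_n_Reals|].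
    apply (Series_correct _ hg). }
  change (is_lim_seq (sum_n L) (Series u)).
  apply is_lim_seq_ext with (fun M => Series u - (Series u - sum_f_R0 L M)).
  { intros M; rewrite sum_n_Reals; simpl; ring. }
  replace (Finite (Series u)) with (Finite (Series u - 0)) by (f_equal; ring).
  apply is_lim_seq_minus'; [apply is_lim_seq_const|].
  apply is_lim_seq_abs_0.
  apply is_lim_seq_le_le with (u := fun _ => 0)
    (w := fun M => Series g - sum_f_R0 g M); try assumption.
  - intros M; split; [apply Rabs_pos | apply hbound].
  - apply is_lim_seq_const.
Qed.

(** Reduces absolute summability to that of the signed sums when the first term alone may be
    positive. *)
Lemma sum_Rabs_nonpos_tail (y : nat -> R) (k : nat) :
  0 <= y 0%nat -> (forall m, (1 <= m)%nat -> y m <= 0) ->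
  sum_f_R0 (fun m => Rabs (y m)) k = 2 * y 0%nat - sum_f_R0 y k.
Proof.
  intros h0 h; induction k as [|k IH].
  - simpl; rewrite Rabs_pos_eq by assumption; ring.
  - rewrite !tech5, IH, (Rabs_left1 (y (S k))) by (apply h; lia); ring.
Qed.

Lemma is_series_nonneg_gt (L : nat -> R) (l : R) (m : nat) :
  is_series L l -> (forall n, 0 <= L n) -> (1 <= m)%nat -> 0 < L m ->
  L 0%nat < l.
Proof.
  intros hl hL hm hLm.
  apply Rlt_le_trans with (sum_f_R0 L m).
  - destruct m as [|m]; [lia|].
    rewrite decomp_sum by lia; simpl pred.
    destruct m as [|m]; [simpl; lra|].
    rewrite tech5.
    assert (0 <= sum_f_R0 (fun i => L (S i)) m)
      by (apply cond_pos_sum; intros; apply hL).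
    lra.
  - apply sum_incr; [|assumption].
    apply is_series_Reals in hl; exact hl.
Qed.

Lemma is_series_nonpos (L : nat -> R) (l : R) :
  is_series L l -> (forall n, L n <= 0) -> l <= 0.
Proof.
  intros hl hL.
  change (Rbar_le (Finite l) (Finite 0)).
  apply is_lim_seq_le with (sum_n L) (fun _ => 0).
  - intros n; rewrite sum_n_Reals.
    induction n as [|n IH]; simpl; [apply hL|].
    specialize (hL (S n)); lra.
  - exact hl.
  - apply is_lim_seq_const.
Qed.

(* With P and Q the sums of U and V, the coefficient relation says
   b P + z P' = b Q, that is, (s^b P(-s))' = b s^(b-1) Q(-s) at s = - z. *)
Lemma PSeries_pos_raise (U V : nat -> R) (b : R) :
  0 < b -> 0 < U 0%nat -> CV_radius U = p_infty ->
  (forall k, (b + INR k) * U k = b * V k) ->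
  (forall z, z < 0 -> 0 < PSeries V z) ->
  forall z, z < 0 -> 0 < PSeries U z.
Proof.
  intros hb hU0 hU hUV hV.
  assert (hUz : forall z, ex_pseries U z)
    by (intros; apply ex_pseries_of_infinite_radius; assumption).
  assert (hder : forall z, is_derive (PSeries U) z (PSeries (PS_derive U) z))
    by (intros; apply is_derive_PSeries; rewrite hU; exact I).
  assert (hrel : forall z, b * PSeries U z + z * PSeries (PS_derive U) z
                           = b * PSeries V z).
  { intros z.
    rewrite <- (PSeries_scal b V), <- (PSeries_scal b U), <- PSeries_incr_1.
    rewrite <- PSeries_plus.
    - apply PSeries_ext; intros k; unfold PS_plus, PS_scal, PS_incr_1, PS_derive.
      change (b * U k + match k with O => 0 | S n => INR (S n) * U (S n) end
              = b * V k).
      rewrite <- hUV; destruct k; [simpl|]; ring.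
    - apply ex_pseries_scal; [apply Rmult_comm | apply hUz].
    - apply ex_pseries_incr_1, ex_pseries_of_infinite_radius.
      rewrite CV_radius_derive; assumption. }
  (* Continuity and P(0) > 0 give positivity near 0, hence a starting point d/2 away from the
     singularity of [ln]. *)
  assert (hnear : exists d, 0 < d /\ forall s, 0 < s < d -> 0 < PSeries U (- s)).
  { assert (hc : continuity_pt (PSeries U) 0)
      by (apply PSeries_continuity; rewrite hU; exact I).
    assert (hl := proj1 (continuity_pt_locally _ _) hc).
    assert (h0 : 0 < PSeries U 0) by (rewrite PSeries_0; assumption).
    destruct (hl (mkposreal _ h0)) as [d hd]; exists d; split; [apply cond_pos|].
    intros s hs; specialize (hd (- s)).
    assert (hball : ball 0 d (- s)).
    { change (Rabs (- s - 0) < d); rewrite Rminus_0_r, Rabs_Ropp, Rabs_pos_eq; lra. }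
    specialize (hd hball); simpl in hd; apply Rabs_def2 in hd; lra. }
  destruct hnear as [d [hd hnear]].
  intros z hz.
  destruct (Rlt_dec (- z) d) as [hzd|hzd].
  { rewrite <- (Ropp_involutive z); apply hnear; lra. }
  (* This is s^b P(-s), whose derivative is positive for s > 0 because Q is positive on the negative
     axis. *)
  set (phi := fun s => exp (b * ln s) * PSeries U (- s)).
  assert (hphi : forall s, 0 < s ->
    is_derive phi s (exp (b * ln s) / s * (b * PSeries V (- s)))).
  { intros s hs; unfold phi; rewrite <- hrel.
    evar_last.
    - apply (is_derive_mult (fun s => exp (b * ln s)) (fun s => PSeries U (- s)) s
               (exp (b * ln s) * (b * / s)) (- PSeries (PS_derive U) (- s))).
      + auto_derive; [assumption|ring].
      + evar_last.
        * apply (is_derive_comp (PSeries U) Ropp s); [apply hder|].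
          auto_derive; [trivial|reflexivity].
        * unfold scal; simpl; unfold mult; simpl; ring.
      + intros; apply Rmult_comm.
    - unfold plus, mult; simpl; field; lra. }
  destruct (MVT_gen phi (d / 2) (- z)
    (fun s => exp (b * ln s) / s * (b * PSeries V (- s)))) as [c [hc he]].
  - intros s hs; rewrite Rmin_left in hs by lra; apply hphi; lra.
  - intros s hs; rewrite Rmin_left in hs by lra.
    apply derivable_continuous_pt.
    eexists; apply is_derive_Reals, hphi; lra.
  - rewrite Rmin_left in hc by lra.
    assert (h1 : 0 < phi (d / 2)).
    { apply Rmult_lt_0_compat; [apply exp_pos | apply hnear; lra]. }
    assert (h2 : 0 < exp (b * ln c) / c * (b * PSeries V (- c))).
    { apply Rmult_lt_0_compat.
      - apply Rdiv_lt_0_compat; [apply exp_pos | lra].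
      - apply Rmult_lt_0_compat; [assumption | apply hV; lra]. }
    assert (h3 : 0 < phi (- z)).
    { assert (h4 := Rmult_lt_0_compat _ (- z - d / 2) h2 ltac:(lra)); lra. }
    unfold phi in h3; rewrite Ropp_involutive in h3.
    apply Rmult_lt_reg_l with (exp (b * ln (- z))); [apply exp_pos | lra].
Qed.

(** * Hypergeometric and Bessel coefficients, zeros and positivity of Bessel series *)

Definition hypCoef (a b c : R) (k : nat) : R :=
  poch a k / (INR (fact k) * poch b k * poch c k).

Lemma hypCoef_pos (a b c : R) (k : nat) :
  0 < a -> 0 < b -> 0 < c -> 0 < hypCoef a b c k.
Proof.
  intros; apply Rdiv_lt_0_compat; [apply poch_pos; assumption|].
  repeat apply Rmult_lt_0_compat; try apply poch_pos; try apply INR_fact_lt_0;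
    assumption.
Qed.

Lemma besselCoef_pos (beta : R) (k : nat) : 0 < beta -> 0 < besselCoef beta k.
Proof.
  intros; apply Rdiv_lt_0_compat; [lra|].
  apply Rmult_lt_0_compat; [apply INR_fact_lt_0 | apply poch_pos; assumption].
Qed.

Lemma CV_radius_hypCoef (a b c : R) :
  0 < a -> 0 < b -> 0 < c -> CV_radius (hypCoef a b c) = p_infty.
Proof.
  intros ha hb hc.
  (* The quotient to bound is (a+n) / ((b+n)(c+n)), where a + n <= (a/b + 1)(b + n) and c <= c +
     n. *)
  apply CV_radius_infinite_of_ratio with ((a / b + 1) / c).
  - intros; apply hypCoef_pos; assumption.
  - intros n; pose proof (hypCoef_pos a b c n ha hb hc) as hu.
    pose proof (pos_INR n) as hn.
    pose proof (poch_pos b n hb); pose proof (poch_pos c n hc).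
    replace (hypCoef a b c (S n) * INR (S n))
      with ((a + INR n) / ((b + INR n) * (c + INR n)) * hypCoef a b c n).
    2:{ unfold hypCoef; rewrite fact_simpl, mult_INR; cbn [poch].
        pose proof (INR_fact_neq_0 n).
        field; repeat split; try lra; apply not_0_INR; lia. }
    apply Rmult_le_compat_r; [lra|].
    apply Rle_div_l; [apply Rmult_lt_0_compat; lra|].
    replace ((a / b + 1) / c * ((b + INR n) * (c + INR n)))
      with (a + INR n + (INR n * a / b + b + (a + b + INR n * a / b + INR n) * INR n / c))
      by (field; lra).
    assert (0 <= INR n * a / b).
    { apply Rdiv_le_0_compat; [apply Rmult_le_pos; lra | lra]. }
    assert (0 <= (a + b + INR n * a / b + INR n) * INR n / c).
    { apply Rdiv_le_0_compat; [apply Rmult_le_pos; lra | lra]. }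
    lra.
Qed.

Lemma CV_radius_besselCoef (beta : R) :
  0 < beta -> CV_radius (besselCoef beta) = p_infty.
Proof.
  (* In 1F2(1; 1, beta) the equal parameters cancel, leaving 0F1(beta). *)
  intros hb; rewrite <- (CV_radius_hypCoef 1 1 beta) by lra.
  apply CV_radius_ext; intros n; unfold besselCoef, hypCoef.
  pose proof (poch_pos 1 n ltac:(lra)); pose proof (poch_pos beta n hb).
  pose proof (INR_fact_neq_0 n); field; repeat split; lra.
Qed.

(** The three-term recurrence of the Bessel functions of orders beta - 1, beta and beta + 1, in 0F1
    normalization; it is checked coefficientwise. *)
Lemma besselCoef_recurrence (beta z : R) :
  0 < beta ->
  PSeries (besselCoef beta) z
  = PSeries (besselCoef (beta + 1)) z
    + z / (beta * (beta + 1)) * PSeries (besselCoef (beta + 2)) z.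
Proof.
  intros hb.
  assert (h : forall c, 0 < c -> ex_pseries (besselCoef c) z).
  { intros; apply ex_pseries_of_infinite_radius, CV_radius_besselCoef; assumption. }
  replace (z / (beta * (beta + 1)) * PSeries (besselCoef (beta + 2)) z)
    with (/ (beta * (beta + 1)) * (z * PSeries (besselCoef (beta + 2)) z))
    by (field; lra).
  rewrite <- PSeries_incr_1, <- PSeries_scal, <- PSeries_plus.
  - apply PSeries_ext; intros k; unfold PS_plus, PS_scal, PS_incr_1.
    unfold plus, scal, zero; simpl; unfold mult; simpl.
    unfold besselCoef; destruct k as [|k]; [simpl; field; lra|].
    rewrite !(poch_succ_l beta), fact_simpl, mult_INR.
    pose proof (poch_pos (beta + 1) k ltac:(lra)) as h1.
    assert (e : poch (beta + 1) (S k) = (beta + 1) * poch (beta + 2) k).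
    { rewrite poch_succ_l; do 2 f_equal; ring. }
    assert (e' : poch (beta + 1) k * (beta + 1 + INR k)
                 = (beta + 1) * poch (beta + 2) k) by exact e.
    rewrite e.
    pose proof (pos_INR k).
    replace (poch (beta + 1) k)
      with ((beta + 1) * poch (beta + 2) k / (beta + 1 + INR k))
      by (rewrite <- e'; field; lra).
    pose proof (poch_pos (beta + 2) k ltac:(lra)).
    pose proof (INR_fact_neq_0 k).
    rewrite S_INR; field; repeat split; lra.
  - apply h; lra.
  - apply ex_pseries_scal; [apply Rmult_comm|].
    apply ex_pseries_incr_1, h; lra.
Qed.

(** The coefficient relation that [PSeries_pos_raise] asks for. *)
Lemma besselCoef_raise (beta : R) (k : nat) :
  0 < beta ->
  (beta + INR k) * besselCoef (beta + 1) k = beta * besselCoef beta k.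
Proof.
  intros hb; unfold besselCoef.
  pose proof (poch_succ_l beta k) as e; cbn [poch] in e.
  pose proof (poch_pos beta k hb); pose proof (pos_INR k).
  replace (poch (beta + 1) k) with (poch beta k * (beta + INR k) / beta)
    by (rewrite e; field; lra).
  pose proof (INR_fact_neq_0 k); field; repeat split; lra.
Qed.

(** The parameter b enters only through a factor [besselCoef b k]. *)
Lemma hypCoef_raise (a b c : R) (k : nat) :
  0 < b -> 0 < c ->
  (b + INR k) * hypCoef a (b + 1) c k = b * hypCoef a b c k.
Proof.
  intros hb hc.
  assert (e : forall beta, 0 < beta ->
    hypCoef a beta c k = poch a k / poch c k * besselCoef beta k).
  { intros beta hbeta; unfold hypCoef, besselCoef.
    pose proof (poch_pos beta k hbeta); pose proof (poch_pos c k hc).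
    pose proof (INR_fact_neq_0 k); field; repeat split; lra. }
  rewrite !e by lra.
  rewrite Rmult_comm, Rmult_assoc, (Rmult_comm _ (b + INR k)), besselCoef_raise
    by assumption; ring.
Qed.

(* If the functions of orders b, ..., b + 3 were all positive at s < 0, the
   recurrence at b + 1 would make the one of order b + 1 smaller than the one of
   order b + 2, and the recurrence at b would then bound -s by b(b+1). *)
Lemma bessel_zero (b : R) :
  0 < b -> exists z, z < 0 /\ PSeries (besselCoef b) z = 0.
Proof.
  intros hb.
  assert (hneg : exists z, z < 0 /\ PSeries (besselCoef b) z <= 0).
  { apply NNPP; intros hn.
    assert (h0 : forall z, z < 0 -> 0 < PSeries (besselCoef b) z).
    { intros z hz; apply Rnot_le_lt; intros hle; apply hn; exists z; auto. }
    assert (hstep : forall c, 0 < c ->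
      (forall z, z < 0 -> 0 < PSeries (besselCoef c) z) ->
      (forall z, z < 0 -> 0 < PSeries (besselCoef (c + 1)) z)).
    { intros c hc; apply PSeries_pos_raise with c; [assumption| | |].
      - apply besselCoef_pos; lra.
      - apply CV_radius_besselCoef; lra.
      - intros; apply besselCoef_raise; assumption. }
    assert (h1 := hstep b hb h0).
    assert (h2 := hstep (b + 1) ltac:(lra) h1).
    assert (h3 := hstep (b + 1 + 1) ltac:(lra) h2).
    replace (b + 1 + 1) with (b + 2) in h2, h3 by ring.
    (* Chosen so that z / (b (b+1)) = -1: expanding F_b and then F_(b+1) by the recurrence, the two
       F_(b+2) terms cancel and a negative term remains. *)
    set (z := - (b * (b + 1))).
    assert (hz : z < 0) by (unfold z; apply Ropp_lt_gt_0_contravar, Rmult_lt_0_compat; lra).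
    specialize (h0 z hz); specialize (h1 z hz); specialize (h2 z hz);
      specialize (h3 z hz).
    rewrite besselCoef_recurrence in h0 by assumption.
    rewrite besselCoef_recurrence in h1 by lra.
    replace (b + 1 + 1) with (b + 2) in h1 by ring.
    replace (b + 1 + 2) with (b + 2 + 1) in h1 by ring.
    rewrite (besselCoef_recurrence (b + 1)) in h0 by lra.
    replace (b + 1 + 1) with (b + 2) in h0 by ring.
    replace (b + 1 + 2) with (b + 2 + 1) in h0 by ring.
    replace (z / (b * (b + 1))) with (-1) in h0 by (unfold z; field; lra).
    assert (h4 : z / ((b + 1) * (b + 2)) * PSeries (besselCoef (b + 2 + 1)) z < 0).
    { replace (z / ((b + 1) * (b + 2))) with (- (b / (b + 2)))
        by (unfold z; field; lra).
      assert (0 < b / (b + 2)) by (apply Rdiv_lt_0_compat; lra).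
      rewrite Ropp_mult_distr_l_reverse; apply Ropp_lt_gt_0_contravar.
      apply Rmult_lt_0_compat; assumption. }
    lra. }
  destruct hneg as [z [hz hle]].
  assert (h1 : PSeries (besselCoef b) 0 = 1)
    by (rewrite PSeries_0; unfold besselCoef; simpl; field).
  destruct (IVT_gen (PSeries (besselCoef b)) z 0 0) as [x [hx e]].
  - intros x; apply PSeries_continuity.
    rewrite CV_radius_besselCoef by assumption; exact I.
  - rewrite h1, Rmin_left, Rmax_right; lra.
  - exists x; split; [|assumption].
    rewrite Rmin_left, Rmax_right in hx by lra.
    destruct (Req_dec x 0) as [->|]; lra.
Qed.

(** Provides a nonzero square of positive index, which makes the final bound strict. Write F_beta(z)
    = 1 + zT; the coefficients of T are at most 1/(k! beta), so |T| <= exp |z| / beta, and the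
    choice of B gives |zT| < 1. *)
Lemma bessel_pos_of_large (z : R) :
  exists B, forall beta, B <= beta -> 0 < PSeries (besselCoef beta) z.
Proof.
  exists (Rabs z * exp (Rabs z) + 1); intros beta hB.
  assert (he := Rmult_le_pos _ _ (Rabs_pos z) (Rlt_le _ _ (exp_pos (Rabs z)))).
  assert (hex : ex_pseries (besselCoef beta) z)
    by (apply ex_pseries_of_infinite_radius, CV_radius_besselCoef; lra).
  rewrite PSeries_decr_1 by assumption.
  replace (besselCoef beta 0) with 1 by (unfold besselCoef; simpl; field).
  set (T := PSeries (PS_decr_1 (besselCoef beta)) z).
  enough (hT : Rabs T <= exp (Rabs z) / beta).
  { assert (h : Rabs (z * T) < 1).
    { rewrite Rabs_mult.
      apply Rle_lt_trans with (Rabs z * (exp (Rabs z) / beta)).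
      - apply Rmult_le_compat_l; [apply Rabs_pos | assumption].
      - unfold Rdiv; rewrite <- Rmult_assoc; apply Rlt_div_l; lra. }
    apply Rabs_def2 in h; lra. }
  assert (hexp : is_series (fun k => / INR (fact k) * Rabs z ^ k / beta)
                           (exp (Rabs z) / beta)).
  { apply (is_series_scal_r (/ beta)); apply is_pseries_R, is_exp_Reals. }
  assert (hle : forall k, Rabs (PS_decr_1 (besselCoef beta) k * z ^ k)
                          <= / INR (fact k) * Rabs z ^ k / beta).
  { intros k; rewrite Rabs_mult, RPow_abs.
    unfold PS_decr_1; rewrite Rabs_pos_eq by (apply Rlt_le, besselCoef_pos; lra).
    unfold Rdiv; rewrite Rmult_assoc, (Rmult_comm (Rabs (z ^ k))), <- Rmult_assoc.
    apply Rmult_le_compat_r; [apply Rabs_pos|].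
    unfold besselCoef; rewrite fact_simpl, mult_INR, poch_succ_l.
    rewrite <- Rinv_mult; unfold Rdiv; rewrite Rmult_1_l.
    pose proof (INR_fact_lt_0 k) as hf.
    assert (hp : 1 <= poch (beta + 1) k).
    { clear - hB he; induction k as [|k IH]; simpl; [lra|].
      pose proof (pos_INR k).
      pose proof (Rmult_le_compat 1 (poch (beta + 1) k) 1 (beta + 1 + INR k)); lra. }
    assert (hk : 1 <= INR (S k)) by (apply (le_INR 1); lia).
    apply Rinv_le_contravar; [apply Rmult_lt_0_compat; lra|].
    replace (INR (S k) * INR (fact k) * (beta * poch (beta + 1) k))
      with (INR (fact k) * beta * (INR (S k) * poch (beta + 1) k)) by ring.
    rewrite <- (Rmult_1_r (INR (fact k) * beta)) at 1.
    apply Rmult_le_compat_l; [apply Rmult_le_pos; lra|].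
    pose proof (Rmult_le_compat 1 (INR (S k)) 1 (poch (beta + 1) k)); lra. }
  rewrite <- (is_series_unique _ _ hexp); unfold T, PSeries.
  eapply Rle_trans; [apply Series_Rabs|].
  - refine (@ex_series_le R_AbsRing R_CompleteNormedModule _ _ _
              (ex_intro _ _ hexp)); intros k.
    change (Rabs (Rabs (PS_decr_1 (besselCoef beta) k * z ^ k))
            <= / INR (fact k) * Rabs z ^ k / beta).
    rewrite Rabs_Rabsolu; apply hle.
  - apply Series_le; [|eexists; apply hexp].
    intros k; split; [apply Rabs_pos | apply hle].
Qed.

(** * The expansion as a convergent sum of squares *)

Lemma besselCoef_sqr_shift_nonneg (beta : R) (n k : nat) :
  0 < beta ->
  0 <= PS_incr_n (PS_mult (besselCoef beta) (besselCoef beta)) n k.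
Proof.
  intros hb; rewrite PS_incr_n_simplify.
  destruct (le_lt_dec n k); [|apply Rle_refl].
  apply cond_pos_sum; intros i.
  apply Rlt_le, Rmult_lt_0_compat; apply besselCoef_pos; assumption.
Qed.

Lemma is_series_besselCoef_sqr_shift (beta w : R) (n : nat) :
  0 < beta ->
  is_series (fun k => PS_incr_n (PS_mult (besselCoef beta) (besselCoef beta)) n k
                      * w ^ k)
            (w ^ n * PSeries (besselCoef beta) w ^ 2).
Proof.
  intros hb; apply is_pseries_R.
  assert (hr : Rbar_lt (Rabs w) (CV_radius (besselCoef beta)))
    by (rewrite CV_radius_besselCoef by assumption; exact I).
  assert (h := PSeries_correct _ _ (CV_radius_inside _ _ hr)).
  evar_last.
  - apply is_pseries_incr_n, is_pseries_mult; eassumption.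
  - rewrite pow_n_pow; unfold scal; simpl; unfold mult; simpl; ring.
Qed.

(* [w] is the argument -x^2/16 of the Bessel series in bbJ _ (x/2). *)
Lemma hyp_sum_of_squares (a b w : R) :
  0 < a -> 0 < b -> a - 1 / 2 < b ->
  is_series (fun m => sqCoef a b m / poch b (2 * m) ^ 2
     * (w ^ (2 * m) * PSeries (besselCoef (b + INR (2 * m))) w ^ 2))
    (PSeries (hypCoef a b (2 * a)) (4 * w)).
Proof.
  intros ha hb hab.
  assert (hbm : forall m, 0 < b + INR (2 * m))
    by (intros m; pose proof (pos_INR (2 * m)); lra).
  set (D := fun m => PS_incr_n (PS_mult (besselCoef (b + INR (2 * m)))
                                        (besselCoef (b + INR (2 * m)))) (2 * m)).
  set (C := fun m => sqCoef a b m / poch b (2 * m) ^ 2).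
  assert (hD : forall m k, 0 <= D m k)
    by (intros; apply besselCoef_sqr_shift_nonneg, hbm).
  assert (hCD : forall v k, sum_f_R0 (fun m => C m * (D m k * v ^ k)) k
                            = hypCoef a b (2 * a) k * (4 * v) ^ k).
  { intros v k.
    rewrite (sum_eq _ (fun m => C m * D m k * v ^ k)) by (intros; ring).
    assert (e := sqCoef_expansion a b k ha hb).
    change (sum_f_R0 (fun m => C m * D m k) k = 4 ^ k * hypCoef a b (2 * a) k) in e.
    rewrite <- scal_sum, e, Rpow_mult_distr.
    ring. }
  assert (hp : forall k, 0 < poch b k) by (intros; apply poch_pos; assumption).
  assert (hs : forall m v, is_series (fun k => D m k * v ^ k)
                 (v ^ (2 * m) * PSeries (besselCoef (b + INR (2 * m))) v ^ 2))
    by (intros; apply is_series_besselCoef_sqr_shift, hbm).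
  assert (hhyp : forall v, ex_series (fun k => hypCoef a b (2 * a) k * (4 * v) ^ k)).
  { intros v; apply ex_pseries_R, ex_pseries_of_infinite_radius, CV_radius_hypCoef;
      lra. }
  unfold PSeries at 2.
  rewrite (Series_ext _ (fun k => sum_f_R0 (fun m => C m * (D m k * w ^ k)) k))
    by (intros; rewrite hCD; reflexivity).
  apply (is_series_triangular (fun m k => C m * (D m k * w ^ k))).
  - intros m k hmk; unfold D; rewrite PS_incr_n_simplify.
    destruct (le_lt_dec (2 * m) k); [lia|].
    unfold zero; simpl; ring.
  - intros m; apply (is_series_scal (C m) (fun k => D m k * w ^ k)), hs.
  (* Absolute summability is tested at |w|, where the sign of each entry is that of c_m. *)
  - set (v := Rabs w).
    assert (hv : forall k, 0 <= v ^ k) by (intros; apply pow_le, Rabs_pos).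
    assert (habs : forall m k, Rabs (C m * (D m k * w ^ k))
                               = Rabs (C m * (D m k * v ^ k))).
    { intros m k; unfold v; rewrite !Rabs_mult, RPow_abs, Rabs_Rabsolu.
      reflexivity. }
    assert (hDv : forall m k, 0 <= D m k * v ^ k)
      by (intros; apply Rmult_le_pos; auto).
    destruct (Rlt_le_dec (a + 1 / 2) b) as [hgt|hle].
    (* All c_m are positive, so the absolute column sums are the terms of the 1F2 series at 4v. *)
    + apply ex_series_ext with (2 := hhyp v); intros k.
      rewrite <- hCD; apply sum_eq; intros m _.
      rewrite habs, Rabs_pos_eq; [reflexivity|].
      apply Rmult_le_pos; [|apply hDv].
      apply Rlt_le, Rdiv_lt_0_compat; [apply sqCoef_pos; assumption|].
      apply pow_lt, hp.
    + assert (hC0 : C 0%nat = 1) by (unfold C; simpl; field).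
      assert (hCm : forall m, (1 <= m)%nat -> C m <= 0).
      { intros m hm; unfold C.
        pose proof (sqCoef_nonpos a b m ha hb hab hle hm).
        assert (0 < / poch b (2 * m) ^ 2) by apply Rinv_0_lt_compat, pow_lt, hp.
        unfold Rdiv; rewrite <- (Ropp_involutive (sqCoef a b m)).
        rewrite Ropp_mult_distr_l_reverse.
        apply Rge_le, Ropp_0_le_ge_contravar, Rmult_le_pos; lra. }
      (* Only m = 0 counts positively, so each absolute column sum is twice its entry m = 0 minus
         the term of the 1F2 series. *)
      apply ex_series_ext with
        (fun k => 2 * (D 0%nat k * v ^ k) - hypCoef a b (2 * a) k * (4 * v) ^ k).
      * intros k.
        rewrite (sum_eq _ (fun m => Rabs (C m * (D m k * v ^ k))))
          by (intros; apply habs).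
        rewrite (sum_Rabs_nonpos_tail (fun m => C m * (D m k * v ^ k))), hCD, hC0.
        -- rewrite Rmult_1_l; reflexivity.
        -- rewrite hC0, Rmult_1_l; apply hDv.
        -- intros m hm; specialize (hCm m hm); specialize (hDv m k).
           assert (h := Rmult_le_pos (- C m) _ ltac:(lra) hDv); lra.
      * apply (ex_series_minus (fun k => 2 * (D 0%nat k * v ^ k))); [|apply hhyp].
        apply (ex_series_scal 2 (fun k => D 0%nat k * v ^ k)).
        eexists; apply hs.
Qed.

(** * The strict lower bound, the necessity of b > a + 1/2, and the conclusion *)

Lemma F12_PSeries (a b c x : R) :
  F12 a b c x = PSeries (hypCoef a b c) (- x ^ 2 / 4).
Proof. reflexivity. Qed.

Lemma bbJ_PSeries (b x : R) :
  bbJ (b - 1) x = PSeries (besselCoef b) (- x ^ 2 / 4).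
Proof. unfold bbJ; replace (b - 1 + 1) with b by ring; reflexivity. Qed.

Lemma hyp_gt_bessel_sqr (a b w : R) :
  0 < a -> 0 < b -> a + 1 / 2 < b -> w < 0 ->
  PSeries (besselCoef b) w ^ 2 < PSeries (hypCoef a b (2 * a)) (4 * w).
Proof.
  intros ha hb hab hw.
  assert (h := hyp_sum_of_squares a b w ha hb ltac:(lra)).
  destruct (bessel_pos_of_large w) as [B hB].
  destruct (INR_unbounded B) as [m hm].
  assert (hc : forall m, 0 < sqCoef a b m / poch b (2 * m) ^ 2).
  { intros k; apply Rdiv_lt_0_compat; [apply sqCoef_pos; assumption|].
    apply pow_lt, poch_pos; assumption. }
  assert (hpow : forall m, 0 < w ^ (2 * m)).
  { intros k; rewrite pow_mult; apply pow_lt, pow2_gt_0; lra. }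
  (* Index m + 1 is at least 1, and b + 2(m+1) > B because m > B. *)
  assert (h0 := is_series_nonneg_gt _ _ (S m) h).
  cbv beta in h0.
  replace (sqCoef a b 0 / poch b (2 * 0) ^ 2 *
    (w ^ (2 * 0) * PSeries (besselCoef (b + INR (2 * 0))) w ^ 2))
    with (PSeries (besselCoef b) w ^ 2) in h0.
  2:{ simpl (2 * 0)%nat; simpl (INR 0); rewrite Rplus_0_r; simpl; field. }
  apply h0; [|lia|].
  - intros n; apply Rmult_le_pos; [apply Rlt_le, hc|].
    apply Rmult_le_pos; [apply Rlt_le, hpow | apply pow2_ge_0].
  - apply Rmult_lt_0_compat; [apply hc|].
    apply Rmult_lt_0_compat; [apply hpow|].
    apply pow_lt, hB.
    assert (INR m <= INR (2 * S m)) by (apply le_INR; lia); lra.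
Qed.

(** The square m = 0 vanishes at w; all others carry coefficients c_m <= 0 and even powers of w. *)
Lemma hyp_nonpos_at_bessel_zero (a b w : R) :
  0 < a -> 0 < b -> a - 1 / 2 < b -> b <= a + 1 / 2 ->
  PSeries (besselCoef b) w = 0 ->
  PSeries (hypCoef a b (2 * a)) (4 * w) <= 0.
Proof.
  intros ha hb h1 h2 hw.
  apply (is_series_nonpos _ _ (hyp_sum_of_squares a b w ha hb h1)).
  intros m; destruct m as [|m].
  - simpl (2 * 0)%nat; simpl (INR 0); rewrite Rplus_0_r, hw; simpl; right; ring.
  - assert (hs := sqCoef_nonpos a b (S m) ha hb h1 h2 ltac:(lia)).
    assert (hp : 0 < / poch b (2 * S m) ^ 2)
      by apply Rinv_0_lt_compat, pow_lt, poch_pos, hb.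
    assert (hq : 0 <= w ^ (2 * S m) * PSeries (besselCoef (b + INR (2 * S m))) w ^ 2).
    { apply Rmult_le_pos; [|apply pow2_ge_0].
      rewrite pow_mult; apply pow_le, pow2_ge_0. }
    assert (h := Rmult_le_pos (- sqCoef a b (S m)) _ ltac:(lra)
                   (Rmult_le_pos _ _ (Rlt_le _ _ hp) hq)).
    unfold Rdiv; lra.
Qed.

(** Induction on some n with b + n > a - 1/2, generalizing over b: either b > a - 1/2 and a Bessel
    zero decides, or positivity is passed on to b + 1. *)
Lemma hyp_pos_necessary (a b : R) :
  0 < a -> 0 < b ->
  (forall z, z < 0 -> 0 < PSeries (hypCoef a b (2 * a)) z) ->
  a + 1 / 2 < b.
Proof.
  intros ha hb hpos.
  destruct (INR_unbounded (a - b)) as [n hn].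
  assert (hn' : a - 1 / 2 < b + INR n) by lra.
  clear hn; revert b hb hpos hn'.
  induction n as [|n IH]; intros b hb hpos hn.
  - simpl in hn; rewrite Rplus_0_r in hn.
    apply Rnot_le_lt; intros hle.
    destruct (bessel_zero b hb) as [w [hw e]].
    pose proof (hyp_nonpos_at_bessel_zero a b w ha hb hn hle e).
    specialize (hpos (4 * w) ltac:(lra)); lra.
  - destruct (Rlt_le_dec (a + 1 / 2) b) as [|hle]; [assumption|exfalso].
    destruct (Rlt_le_dec (a - 1 / 2) b) as [hlt|hle'].
    + destruct (bessel_zero b hb) as [w [hw e]].
      pose proof (hyp_nonpos_at_bessel_zero a b w ha hb hlt hle e).
      specialize (hpos (4 * w) ltac:(lra)); lra.
    (* Contradicts b <= a - 1/2. *)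
    + enough (a + 1 / 2 < b + 1) by lra.
      apply IH; [lra| |rewrite S_INR in hn; lra].
      apply (PSeries_pos_raise (hypCoef a (b + 1) (2 * a))
               (hypCoef a b (2 * a)) b); [assumption| | | |assumption].
      * apply hypCoef_pos; lra.
      * apply CV_radius_hypCoef; lra.
      * intros k; apply hypCoef_raise; lra.
Qed.

Theorem theorem5 (a b : R) (ha : 0 < a) (hb : 0 < b) :
  (in_P12 a b (2 * a) <-> a + 1 / 2 < b) /\
  (a + 1 / 2 < b ->
   forall x : R, 0 < x -> (bbJ (b - 1) (x / 2)) ^ 2 < F12 a b (2 * a) x).
Proof.
  assert (hgt : a + 1 / 2 < b ->
    forall x : R, 0 < x -> (bbJ (b - 1) (x / 2)) ^ 2 < F12 a b (2 * a) x).
  { intros hab x hx; rewrite bbJ_PSeries, F12_PSeries.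
    (* With w = -(x/2)^2/4 the 1F2 argument is 4w, while w is the argument of the Bessel series at
       x/2. *)
    replace (- x ^ 2 / 4) with (4 * (- (x / 2) ^ 2 / 4)) by field.
    apply hyp_gt_bessel_sqr; try assumption.
    assert (0 < (x / 2) ^ 2) by (apply pow_lt; lra); lra. }
  split; [split|exact hgt].
  - intros (_ & _ & _ & hpos); apply hyp_pos_necessary; [assumption..|].
    intros z hz.
    (* The positive solution x of -x^2/4 = z. *)
    specialize (hpos (2 * sqrt (- z)) ltac:(apply Rmult_lt_0_compat;
      [lra | apply sqrt_lt_R0; lra])).
    rewrite F12_PSeries, Rpow_mult_distr, pow2_sqrt in hpos by lra.
    replace (- (2 ^ 2 * - z) / 4) with z in hpos by field.
    exact hpos.
  - intros hab; unfold in_P12; repeat split; try lra.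
    intros x hx; specialize (hgt hab x hx).
    pose proof (pow2_ge_0 (bbJ (b - 1) (x / 2))); lra.
Qed.
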